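(* Let $G = B \,\mathrm{wr}\, X$ be a self-similar wreath product of abelian groups $B$ and $X$. If $X$ is torsion-free, then $B$ is a torsion group of finite exponent. In particular, $\mathbb{Z}\,\mathrm{wr}\,\mathbb{Z}$ cannot be self-similar.
   Context: The wreath product $B\,\mathrm{wr}\,X$ is the restricted (regular) one: $B\,\mathrm{wr}\,X = A \rtimes X$, where $A=\bigoplus_{x\in X} B^x$ is a direct sum of copies of $B$ indexed by $X$, permuted regularly by $X$ by conjugation. For a finite set $Y$ of size $m$, let $\mathcal{T}(Y)$ be the one-rooted regular $m$-ary tree whose vertices are the finite sequences over $Y$, and let $\mathcal{A}(Y)$ be its automorphism group. Each automorphism of the tree is identified with an automaton on the alphabet $Y$ whose states are again automorphisms of the tree (the state of $g$ at a vertex $u$ is the automorphism $g_u$ determined by $(uw)^g = u^g w^{g_u}$). A subgroup of $\mathcal{A}(Y)$ is state-closed if all states of its elements belong to the subgroup, and transitive if it acts transitively on the first level of the tree. A group $G$ is self-similar if for some finite positive integer $m$ it has a faithful representation as a state-closed and transitive subgroup of $\mathcal{A}(Y)$ with $|Y|=m$. Equivalently, $G$ is self-similar if and only if there exist a subgroup $H$ of finite index in $G$ and a homomorphism $f:H\to G$ such that the only subgroup $K\le H$ which is normal in $G$ and satisfies $K^f\le K$ is the trivial one (here $K^f$ denotes the image of $K$ under $f$).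
   Formalization: X is assumed to be nontrivial; for trivial X the claim fails, since then G = B and B = Z is self-similar (take H = 2Z and f(2n) = n) but has no finite exponent. *)

(* Defs.v *)
From HB Require Import structures.
From mathcomp Require Import all_boot all_order all_algebra all_fingroup.
From mathcomp Require Import finmap boolp classical_sets.
From mathcomp.multinomials Require Import monalg.

Set Implicit Arguments.
Unset Strict Implicit.
Unset Printing Implicit Defensive.

Import GRing.Theory.

Local Open Scope ring_scope.

(** Abelian groups are written additively ([zmodType]). *)

Definition torsion_free (X : zmodType) : Prop :=
  forall (x : X) (n : nat), (0 < n)%N -> x *+ n = 0 -> x = 0.

Definition finite_exponent (B : zmodType) : Prop :=
  exists2 n : nat, (0 < n)%N & forall b : B, b *+ n = 0.

(** * Restricted regular wreath product *)

(** Only the additive group of [{malg B[X]}] is used: it is the group of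
    finitely supported functions [X -> B], i.e. the direct sum of copies of [B]
    indexed by [X].  [shift x] moves the copy of index [z] to the index [z + x]. *)
Definition shift (B X : zmodType) (x : X) (a : {malg B[X]}) : {malg B[X]} :=
  [malg k in [fset (z + x)%R | z in msupp a]%fset => a@_(k - x)].

Lemma shiftE (B X : zmodType) (x : X) (a : {malg B[X]}) (k : X) :
  (shift x a)@_k = a@_(k - x).
Proof.
rewrite /shift /mcoeff /= fsfun_fun; case: ifP => // /negP kNa.
apply/esym; have [ka|/mcoeff_outdom//] := boolP (k - x \in msupp a).
by case: kNa; apply/imfsetP; exists (k - x); rewrite ?subrK.
Qed.

Lemma shift0 (B X : zmodType) (a : {malg B[X]}) : shift 0 a = a.
Proof. by apply/malgP => k; rewrite shiftE subr0. Qed.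

Lemma shiftD (B X : zmodType) (x y : X) (a : {malg B[X]}) :
  shift (x + y) a = shift y (shift x a).
Proof. by apply/malgP => k; rewrite !shiftE opprD addrA addrAC. Qed.

Lemma shift_add (B X : zmodType) (x : X) (a b : {malg B[X]}) :
  shift x (a + b) = shift x a + shift x b.
Proof. by apply/malgP => k; rewrite mcoeffD !shiftE mcoeffD. Qed.

Lemma shift_zero (B X : zmodType) (x : X) : shift x 0 = 0 :> {malg B[X]}.
Proof. by apply/malgP => k; rewrite shiftE !mcoeff0. Qed.

(** The pair [(x, a)] stands for the product [x a], and [shift x a] is the
    conjugate [x^-1 a x]; hence [(x a) (y b) = x y (y^-1 a y) b]. *)
Definition wreath (B X : zmodType) : Type := (X * {malg B[X]})%type.

Section WreathGroup.
Variables B X : zmodType.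
Implicit Types p q r : wreath B X.

Definition wreath_one : wreath B X := (0, 0).
Definition wreath_mul p q : wreath B X := (p.1 + q.1, shift q.1 p.2 + q.2).
Definition wreath_inv p : wreath B X := (- p.1, - shift (- p.1) p.2).

Lemma wreath_mulA : associative wreath_mul.
Proof.
by move=> p q r; rewrite /wreath_mul /= shift_add -shiftD !addrA.
Qed.

Lemma wreath_1mul : left_id wreath_one wreath_mul.
Proof. by case=> x a; rewrite /wreath_mul /= shift_zero !add0r. Qed.

Lemma wreath_mul1 : right_id wreath_one wreath_mul.
Proof. by case=> x a; rewrite /wreath_mul /= shift0 !addr0. Qed.

Lemma wreath_mulV : right_inverse wreath_one wreath_inv wreath_mul.
Proof. by case=> x a; rewrite /wreath_mul /= !subrr. Qed.

Lemma wreath_Vmul : left_inverse wreath_one wreath_inv wreath_mul.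
Proof.
case=> x a; rewrite /wreath_mul /= addNr.
congr pair; apply/malgP => k.
by rewrite mcoeffD shiftE mcoeffN shiftE opprK subrK addNr mcoeff0.
Qed.

HB.instance Definition _ := Choice.on (wreath B X).
HB.instance Definition _ := isGroup.Build (wreath B X)
  wreath_mulA wreath_1mul wreath_mul1 wreath_Vmul wreath_mulV.
End WreathGroup.

(** * Automorphisms of the regular rooted tree *)

(** The vertices are the finite sequences over [Y], with root [[::]]. *)
Definition child (Y : finType) (u v : seq Y) : bool := [exists y, v == rcons u y].

(** Such a map fixes the root, the only vertex which is not a child. *)
Definition is_tree_aut (Y : finType) (g : seq Y -> seq Y) : Prop :=
  bijective g /\ {mono g : u v / child u v}.

Record tree_aut (Y : finType) : Type := TreeAut {
  tree_aut_fun :> seq Y -> seq Y;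
  _ : `[< is_tree_aut tree_aut_fun >] }.

HB.instance Definition _ (Y : finType) := [isSub for @tree_aut_fun Y].
HB.instance Definition _ (Y : finType) := [Choice of tree_aut Y by <:].

Section TreeAutGroup.
Variable Y : finType.
Implicit Types (g h : tree_aut Y) (u v w : seq Y).

Lemma tree_autP g : is_tree_aut g.
Proof. exact/asboolP/(valP g). Qed.

Lemma tree_aut_ext g h : g =1 h -> g = h.
Proof. by move=> gh; apply/val_inj/funext. Qed.

Lemma tree_aut_one_subproof : `[< is_tree_aut (@id (seq Y)) >].
Proof. by apply/asboolP; split=> //; exists id. Qed.

Definition tree_aut_one : tree_aut Y := TreeAut tree_aut_one_subproof.

Lemma tree_aut_mul_subproof g h : `[< is_tree_aut (h \o g) >].
Proof.
apply/asboolP; have [[bg mg] [bh mh]] := (tree_autP g, tree_autP h).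
by split=> [|u v /=]; [exact: bij_comp | rewrite mh mg].
Qed.

(** Automorphisms act on the right: [u^(g h) = (u^g)^h]. *)
Definition tree_aut_mul g h : tree_aut Y := TreeAut (tree_aut_mul_subproof g h).

Lemma tree_aut_inv_ex g : {h : seq Y -> seq Y | cancel g h /\ cancel h g}.
Proof. by apply: cid; have [[h gK hK] _] := tree_autP g; exists h. Qed.

Lemma tree_aut_inv_subproof g : `[< is_tree_aut (sval (tree_aut_inv_ex g)) >].
Proof.
apply/asboolP; case: (tree_aut_inv_ex g) => h [gK hK] /=.
have [_ mg] := tree_autP g; split; first by exists g.
by move=> u v; rewrite -mg !hK.
Qed.

Definition tree_aut_inv g : tree_aut Y := TreeAut (tree_aut_inv_subproof g).

Lemma tree_aut_mulA : associative tree_aut_mul.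
Proof. by move=> f g h; apply: tree_aut_ext. Qed.

Lemma tree_aut_1mul : left_id tree_aut_one tree_aut_mul.
Proof. by move=> g; apply: tree_aut_ext. Qed.

Lemma tree_aut_mul1 : right_id tree_aut_one tree_aut_mul.
Proof. by move=> g; apply: tree_aut_ext. Qed.

Lemma tree_aut_Vmul : left_inverse tree_aut_one tree_aut_inv tree_aut_mul.
Proof.
move=> g; apply: tree_aut_ext => u /=.
by case: (tree_aut_inv_ex g) => h [gK hK] /=; rewrite hK.
Qed.

Lemma tree_aut_mulV : right_inverse tree_aut_one tree_aut_inv tree_aut_mul.
Proof.
move=> g; apply: tree_aut_ext => u /=.
by case: (tree_aut_inv_ex g) => h [gK hK] /=; rewrite gK.
Qed.

HB.instance Definition _ := isGroup.Build (tree_aut Y)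
  tree_aut_mulA tree_aut_1mul tree_aut_mul1 tree_aut_Vmul tree_aut_mulV.

Lemma childP u v : reflect (exists y, v = rcons u y) (child u v).
Proof. exact: 'exists_eqP. Qed.

Lemma tree_aut_nil g : g [::] = [::].
Proof.
case/lastP E: (g [::]) => [//|u y].
have [[h gK hK] mg] := tree_autP g.
have : child (g (h u)) (g [::]) by rewrite hK E; apply/childP; exists y.
by rewrite mg => /childP[z]; case: (h u).
Qed.

Lemma tree_aut_rcons g u y : exists z, g (rcons u y) = rcons (g u) z.
Proof.
by apply/childP; have [_ ->] := tree_autP g; apply/childP; exists y.
Qed.

Lemma size_tree_aut g u : size (g u) = size u.
Proof.
elim/last_ind: u => [|u y IHu]; first by rewrite tree_aut_nil.
by have [z ->] := tree_aut_rcons g u y; rewrite !size_rcons IHu.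
Qed.

Lemma take_tree_aut g u w : take (size u) (g (u ++ w)) = g u.
Proof.
elim/last_ind: w => [|w y IHw].
  by rewrite cats0 -(size_tree_aut g) take_size.
rewrite -rcons_cat; have [z ->] := tree_aut_rcons g (u ++ w) y.
rewrite -cats1 takel_cat // size_tree_aut size_cat; exact: leq_addr.
Qed.

Definition state_fun g u w : seq Y := drop (size u) (g (u ++ w)).

Lemma state_funE g u w : g (u ++ w) = g u ++ state_fun g u w.
Proof. by rewrite -{1}(take_tree_aut g u w) cat_take_drop. Qed.

Lemma child_cat u v w : child (u ++ v) (u ++ w) = child v w.
Proof.
apply/childP/childP => -[y E]; exists y; last by rewrite E rcons_cat.
by move: E; rewrite rcons_cat => /eqP; rewrite eqseq_cat // eqxx => /eqP.
Qed.

Lemma state_subproof g u : `[< is_tree_aut (state_fun g u) >].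
Proof.
apply/asboolP; have [[h gK hK] mg] := tree_autP g; split; last first.
  by move=> v w; rewrite -(child_cat (g u)) -!state_funE mg child_cat.
have hE w : h (g u ++ w) = u ++ drop (size u) (h (g u ++ w)).
  rewrite -[LHS](cat_take_drop (size u)); congr (_ ++ _).
  pose s := h (g u ++ w).
  have gs : g s = g u ++ w by rewrite /s hK.
  have le_us : (size u <= size s)%N.
    by rewrite -(size_tree_aut g s) gs size_cat size_tree_aut leq_addr.
  apply: (can_inj gK).
  rewrite -(take_tree_aut g (take (size u) s) (drop (size u) s)).
  by rewrite cat_take_drop size_takel // gs -{1}(size_tree_aut g) take_size_cat.
exists (fun w => drop (size u) (h (g u ++ w))) => w.
  by rewrite -state_funE gK drop_size_cat.
by rewrite /state_fun -hE hK drop_size_cat // size_tree_aut.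
Qed.

Definition state g u : tree_aut Y := TreeAut (state_subproof g u).

Lemma stateE g u w : g (u ++ w) = g u ++ state g u w.
Proof. exact: state_funE. Qed.

End TreeAutGroup.

Definition state_closed (Y : finType) (S : set (tree_aut Y)) : Prop :=
  forall (g : tree_aut Y) (u : seq Y), S g -> S (state g u).

Definition transitive_on_first_level (Y : finType) (S : set (tree_aut Y)) : Prop :=
  forall x y : Y, exists2 g : tree_aut Y, S g & g [:: x] = [:: y].

Definition self_similar (G : groupType) : Prop :=
  exists (Y : finType) (phi : {multiplicative G -> tree_aut Y}),
    [/\ (0 < #|Y|)%N, injective phi, state_closed (range phi)
      & transitive_on_first_level (range phi)].

(* Main.v *)
Require Import Defs.
From HB Require Import structures.
From mathcomp Require Import all_boot all_order all_algebra all_fingroup.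
From mathcomp Require Import cyclic finmap boolp classical_sets.
From mathcomp.multinomials Require Import monalg.

Set Implicit Arguments.
Unset Strict Implicit.
Unset Printing Implicit Defensive.

Local Open Scope ring_scope.

Import GRing.Theory.

(** Write [A] for the base group of [G = B wr X].  Let [N] be the kernel of the
    action of [G] on the first level of the tree, [k] the order of the symmetric
    group of that level, and [f] the map sending an element to its state at a
    fixed vertex of the first level.  Then [N] is normal and contains every
    [k]-th power, [f] is a homomorphism on [N], and a subset of [N] that is
    closed under conjugation and under [f] is trivial, because by transitivity
    all states of its elements stay in it and so its elements fix every vertex
    ([self_similar_simple_virtual_endo]).

    Fix [x0 != 0] in [X] and put [x = k x0], [h = (x, 0)], so that [h] and
    [k A] lie in [N].  It suffices to find a conjugation-stable, [f]-stable
    subset of [N] whose triviality forces [k A = 0].  There are two candidates: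
    [k A] itself, and [k (x - 1) A = [k A, h]], which works since [x - 1] acts
    injectively on [A]: a nonzero finitely supported function is not invariant
    under a translation of infinite order.

    - If [f] sends some [a0] of [A] in [N] outside [A], then [f (k (x - 1) A)]
      lies in [A], as it consists of commutators, and commutes with [f a0].
      Elements outside [A] centralize no nonzero element of [A], so [f] kills
      [k (x - 1) A].
    - If [f] sends the part of [A] in [N] into [A] and [f h] is in [A], then [f]
      again kills [k (x - 1) A = [k A, h]], because [A] is abelian.
    - If [f] sends the part of [A] in [N] into [A] and [f h] acts on [A] as a
      translation by [y != 0], then applying [f] to [k (x - 1) a] in two ways,
      where [(x - 1) a = [a, h]] lies in [N], gives
      [k f ((x - 1) a) = (y - 1) f (k a)].  Multiplication by [y - 1] is
      injective on [A / k A] too, since this is the group of finitely supported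
      functions [X -> B / k B]; hence [f (k a)] lies in [k A], which is
      therefore stable under [f]. *)

(** * Simple virtual endomorphisms *)

Lemma multiplicative1 (G H : groupType) (f : {multiplicative G -> H}) :
  f 1%g = 1%g.
Proof. by apply: (@mulgI _ (f 1%g)); rewrite -gmulfM !mulg1. Qed.

(** The map [f] is total for convenience, but only its restriction to [N] is
    meaningful.  In [endo_simple], [K] ranges over all normal subsets rather
    than normal subgroups, so that applying it never requires closure under
    products. *)
Record simple_virtual_endo (G : groupType) (N : G -> Prop) (f : G -> G) :
    Prop := SimpleVirtualEndo {
  dom1 : N 1%g;
  domM : forall g h, N g -> N h -> N (g * h)%g;
  domV : forall g, N g -> N (g^-1)%g;
  domJ : forall g h, N g -> N (g ^ h)%g;
  endoM : forall g h, N g -> N h -> f (g * h)%g = (f g * f h)%g;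
  endo_simple : forall K : G -> Prop,
    (forall g, K g -> N g) -> (forall g h, K g -> K (g ^ h)%g) ->
    (forall g, K g -> K (f g)) -> forall g, K g -> g = 1%g }.

Section VirtualEndo.
Variables (G : groupType) (N : G -> Prop) (f : G -> G).
Hypothesis fP : simple_virtual_endo N f.

Lemma domR g h : N g -> N [~ g, h]%g.
Proof. by move=> Ng; apply: (domM fP); [apply: (domV fP)|apply: (domJ fP)]. Qed.

Lemma endo1 : f 1%g = 1%g.
Proof.
by apply: (@mulgI _ (f 1%g)); rewrite -(endoM fP) ?mulg1 //; apply: (dom1 fP).
Qed.

Lemma endoV g : N g -> f (g^-1)%g = (f g)^-1%g.
Proof.
move=> Ng; apply: (@mulgI _ (f g)); rewrite mulgV -(endoM fP) ?mulgV ?endo1 //.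
exact: (domV fP).
Qed.

Lemma endoX g n : N g -> f (g ^+ n)%g = (f g ^+ n)%g.
Proof.
move=> Ng.
suff [] : N (g ^+ n)%g /\ f (g ^+ n)%g = (f g ^+ n)%g by [].
elim: n => [|n [Nn IHn]]; first by rewrite !expg0 endo1; split=> //; apply: (dom1 fP).
by rewrite !expgS (endoM fP) // IHn; split=> //; apply: (domM fP).
Qed.

Lemma endoR g h : N g -> N h -> f [~ g, h]%g = [~ f g, f h]%g.
Proof.
move=> Ng Nh; have NV := domV fP; have NM := domM fP.
by rewrite !commgEl !conjgE !(endoM fP) ?endoV //; auto.
Qed.

End VirtualEndo.

(** * The action on the first level of the tree *)

Section FirstLevel.
Variable Y : finType.
Implicit Types g h : tree_aut Y.

Lemma state_mul g h u : state (g * h)%g u = (state g u * state h (g u))%g.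
Proof.
apply: tree_aut_ext => w.
have : (g * h)%g (u ++ w) = h (g (u ++ w)) by [].
by rewrite !stateE => /eqP; rewrite eqseq_cat // eqxx => /eqP.
Qed.

Lemma first_level_ex g y : exists z, g [:: y] = [:: z].
Proof. by have [z ->] := tree_aut_rcons g [::] y; rewrite tree_aut_nil; exists z. Qed.

Definition first_level_fun g y : Y := sval (cid (first_level_ex g y)).

Lemma first_level_funE g y : g [:: y] = [:: first_level_fun g y].
Proof. by rewrite /first_level_fun; case: cid. Qed.

Lemma first_level_inj g : injective (first_level_fun g).
Proof.
move=> y z yz; have [/bij_inj g_inj _] := tree_autP g.
by have [//] : [:: y] = [:: z] by apply: g_inj; rewrite !first_level_funE yz.
Qed.

Definition first_level g : {perm Y} := perm (@first_level_inj g).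

Lemma first_levelE g y : g [:: y] = [:: first_level g y].
Proof. by rewrite permE -first_level_funE. Qed.

Lemma first_levelM : {morph first_level : g h / (g * h)%g}.
Proof.
move=> g h; apply/permP => y; rewrite permM.
have : (g * h)%g [:: y] = h (g [:: y]) by [].
by rewrite !first_levelE => -[].
Qed.

HB.instance Definition _ :=
  monoid.isMultiplicative.Build (tree_aut Y) {perm Y} first_level first_levelM.
HB.instance Definition _ :=
  Multiplicative_isUMagmaMorphism.Build (tree_aut Y) {perm Y} first_level
    (multiplicative1 first_level).

End FirstLevel.

(** Taking the kernel of the action on the first level, rather than the
    stabilizer of the vertex [y0], makes the domain of [f] normal and gives one
    exponent [k] with all [k]-th powers in it. *)
Lemma self_similar_simple_virtual_endo (G : groupType) :
  self_similar G ->
  exists (k : nat) (N : G -> Prop) (f : G -> G),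
    [/\ (0 < k)%N, forall g, N (g ^+ k)%g & simple_virtual_endo N f].
Proof.
case=> Y [phi0 [/card_gt0P[y0 _]]].
have [phi <-] : exists phi : UMagmaMorphism.type G (tree_aut Y),
    phi = phi0 :> (G -> tree_aut Y).
  have phi0M : monoid.monoid_morphism phi0 :=
    (multiplicative1 phi0, @gmulfM _ _ phi0).
  pose phi0U := isUMagmaMorphism.Build G (tree_aut Y) phi0 phi0M.
  pose phi : UMagmaMorphism.type G (tree_aut Y) := HB.pack (phi0 : G -> _) phi0U.
  by exists phi.
move=> phi_inj closed trans.
have /boolp.choice[f fE] : forall g, exists h, phi h = state (phi g) [:: y0].
  by move=> g; have [|h _] := closed (phi g) [:: y0]; [exists g | exists h].
pose N g := first_level (phi g) = 1%g.
exists #|[set: {perm Y}]%G|, N, f; split; first exact: cardG_gt0.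
  by move=> g; rewrite /N !gmulfXn expg_cardG ?inE.
have fix1 g y : N g -> phi g [:: y] = [:: y].
  by rewrite /N first_levelE => ->; rewrite perm1.
split; rewrite /N.
- by rewrite !gmulf1.
- by move=> g h Ng Nh; rewrite !gmulfM /= Ng Nh mulg1.
- by move=> g Ng; rewrite !gmulfV /= Ng invg1.
- by move=> g h Ng; rewrite !gmulfJ /= Ng conj1g.
- move=> g h Ng Nh; apply: phi_inj.
  by rewrite gmulfM !fE gmulfM state_mul fix1.
move=> K KN KJ Kf g Kg; apply: phi_inj; rewrite gmulf1.
apply: tree_aut_ext => u.
elim: u g Kg => [|y u IHu] g Kg; first by rewrite tree_aut_nil.
have Ng := KN _ Kg.
rewrite -cat1s stateE fix1 //.
suff [h Kh ->] : exists2 h, K h & state (phi g) [:: y] = phi h by rewrite IHu.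
(* Simplicity only controls states at [y0]; conjugating by some [t] that moves
   [y0] to [y] carries them to states at [y], up to conjugation by a state of
   [t], which lies in the group by state-closure. *)
have [_ [t _ <-] ty] := trans y0 y.
have [s _ sE] : range phi (state (phi t) [:: y0]) by apply: closed; exists t.
have : ((g ^ t^-1) * t = t * g)%g by rewrite conjgE invgK !mulgA mulgVK.
move: (g ^ t^-1)%g (KJ _ t^-1%g Kg) => gt Kgt.
move=> /(congr1 (fun p => state (phi p) [:: y0])).
rewrite !gmulfM !state_mul (fix1 _ y0 (KN _ Kgt)) ty => E.
exists (f gt ^ s)%g; first exact/KJ/Kf.
by rewrite gmulfJ fE sE conjgE E mulKg.
Qed.

(** * Commutators and translations in the wreath product *)

Section Wreath.
Variables B X : zmodType.
Implicit Types (a c d e : {malg B[X]}) (x y z : X) (g h : wreath B X).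

Lemma wreathM g h : (g * h)%g = (g.1 + h.1, shift h.1 g.2 + h.2) :> wreath B X.
Proof. by []. Qed.

Lemma wreathV g : (g^-1)%g = (- g.1, - shift (- g.1) g.2) :> wreath B X.
Proof. by []. Qed.

Definition base a : wreath B X := (0, a).
Definition top x : wreath B X := (x, 0).

Lemma baseX a n : (base a ^+ n)%g = base (a *+ n).
Proof.
elim: n => [//|n IHn].
by rewrite expgS IHn wreathM /= addr0 shift0 mulrS.
Qed.

Lemma topX x n : (top x ^+ n)%g = top (x *+ n).
Proof.
elim: n => [//|n IHn].
by rewrite expgS IHn wreathM /= shift_zero addr0 mulrS.
Qed.

Lemma baseJ a g : (base a ^ g)%g = base (shift g.1 a).
Proof.
rewrite conjgE !wreathM wreathV /= add0r addNr; congr pair.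
apply/malgP => z; rewrite !(mcoeffD, mcoeffN, shiftE) opprK subrK.
by rewrite addrCA addNr addr0.
Qed.

Lemma base_inj : injective base.
Proof. by move=> a c []. Qed.

Lemma shiftN x a : shift x (- a) = - shift x a.
Proof. by apply/malgP => z; rewrite !(mcoeffN, shiftE). Qed.

Lemma shiftMn x a n : shift x (a *+ n) = shift x a *+ n.
Proof. by apply/malgP => z; rewrite !(mcoeffMn, shiftE). Qed.

Lemma shiftC x y a : shift x (shift y a) = shift y (shift x a).
Proof. by rewrite -!shiftD addrC. Qed.

Lemma baseR a g : ([~ base a, g])%g = base (shift g.1 a - a).
Proof.
rewrite commgEl baseJ wreathM wreathV /= !addr0 oppr0 !shift0.
by rewrite addrC.
Qed.

Lemma wreathR1 g h : ([~ g, h])%g.1 = 0 :> X.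
Proof.
by rewrite commgEl conjgE !wreathM !wreathV /= addrA -opprD addNr.
Qed.

Lemma fst0_base g : g.1 = 0 -> g = base g.2.
Proof. by case: g => y c /= ->. Qed.

Hypothesis tfX : torsion_free X.

(** Injectivity of [y - 1] on the finitely supported functions with values in
    [B / k B]: modulo [k B] the function [c] is constant along the progression
    [z - y *+ n], which is infinite and so leaves the support of [c]. *)
Lemma shift_sub_divisible y k c e :
  y != 0 -> shift y c - c = e *+ k -> exists d, c = d *+ k.
Proof.
move=> y0 cE.
have y_inj : injective (fun n => y *+ n).
  have le_inj i j : (i <= j)%N -> y *+ i = y *+ j -> i = j.
    move=> ij eq_ij; apply/eqP; rewrite eqn_leq ij leqNgt -subn_gt0.
    apply/negP => /(@tfX y) H; case/eqP: y0; apply: H.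
    by rewrite mulrnBr // eq_ij subrr.
  by move=> i j; case/orP: (leq_total i j) => /le_inj // H /esym/H.
have vanish z : exists n, c@_(z - y *+ n) = 0.
  pose s := [seq z - y *+ n | n <- iota 0 (size (msupp c)).+1].
  have us : uniq s.
    by rewrite map_inj_uniq ?iota_uniq // => i j /addrI/oppr_inj/y_inj.
  have : ~~ all (fun t => t \in msupp c) s.
    apply/negP => /allP sc; have := uniq_leq_size us sc.
    by rewrite size_map size_iota ltnn.
  by case/allPn => _ /mapP[n _ ->] /mcoeff_outdom; exists n.
have step z n : exists b, c@_(z - y *+ n) - c@_z = b *+ k.
  elim: n => [|n [b bE]]; first by exists 0; rewrite mulr0n subr0 subrr mul0rn.
  exists (b + e@_(z - y *+ n)); rewrite mulrnDl -bE -mcoeffMn -cE mcoeffB shiftE.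
  by rewrite mulrSr opprD addrA [RHS]addrC addrA subrK.
have /boolp.choice[d dE] : forall z, exists b, c@_z = b *+ k.
  move=> z; have [n cn] := vanish z; have [b] := step z n; rewrite cn sub0r.
  by move=> /(congr1 -%R); rewrite opprK -mulNrn; exists (- b).
exists [malg z in msupp c => d z]; apply/malgP => z; rewrite mcoeffMn mcoeffE.
by case: msuppP => // _; rewrite mul0rn.
Qed.

(** This is divisibility by [k] for [k = 0]. *)
Lemma shift_fix_eq0 y c : y != 0 -> shift y c = c -> c = 0.
Proof.
move=> y0 cE; have [|d ->] := @shift_sub_divisible y 0 c 0 y0; last exact: mulr0n.
by rewrite cE subrr.
Qed.

Lemma exponent_of_base k :
  (0 < k)%N -> (forall a, a *+ k = 0) -> finite_exponent B.
Proof.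
move=> k0 Ak; exists k => // b.
by rewrite -(mcoeffUU (0 : X) b) -mcoeffMn Ak mcoeff0.
Qed.

(** * Exponent of the bottom group *)

Variables (k : nat) (N : wreath B X -> Prop) (f : wreath B X -> wreath B X).
Hypotheses (k_gt0 : (0 < k)%N) (Nk : forall g, N (g ^+ k)%g).
Hypothesis fP : simple_virtual_endo N f.

Lemma domMn a : N (base (a *+ k)).
Proof. by rewrite -baseX. Qed.

Lemma exponent_of_killed x :
  x != 0 -> (forall a, f (base ((shift x a - a) *+ k)) = 1%g) ->
  finite_exponent B.
Proof.
move=> x0 fD; apply: (exponent_of_base k_gt0) => a.
apply: (shift_fix_eq0 x0); apply/eqP; rewrite shiftMn -subr_eq0 -mulrnBl; apply/eqP.
apply: base_inj; change (base 0) with (1%g : wreath B X).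
apply: (endo_simple fP (K := fun g => exists a, g = base ((shift x a - a) *+ k))).
- by move=> _ [c ->]; apply: domMn.
- move=> _ h [c ->]; exists (shift h.1 c); rewrite baseJ; congr base.
  by rewrite shiftMn shift_add shiftN shiftC.
- by move=> _ [c ->]; rewrite fD; exists 0; rewrite shift_zero subrr mul0rn.
- by exists a.
Qed.

Lemma exponent_of_invariant :
  (forall a, exists d, f (base (a *+ k)) = base (d *+ k)) -> finite_exponent B.
Proof.
move=> fA; apply: (exponent_of_base k_gt0) => a; apply: base_inj.
apply: (endo_simple fP (K := fun g => exists a, g = base (a *+ k))).
- by move=> _ [c ->]; apply: domMn.
- by move=> _ h [c ->]; exists (shift h.1 c); rewrite baseJ shiftMn.
- by move=> _ [c ->]; apply: fA.
- by exists a.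
Qed.

Lemma commute_base_eq0 a g : g.1 != 0 -> commute (base a) g -> a = 0.
Proof.
move=> g0 /commgP/eqP; rewrite baseR => /base_inj/eqP.
by rewrite subr_eq0 => /eqP /(shift_fix_eq0 g0).
Qed.

(** The three cases depend on whether [f] maps [A] into itself, where it is
    defined, and on the translation [(f h).1] by which [f h] acts on [A]. *)
Lemma simple_virtual_endo_exponent x : x != 0 -> finite_exponent B.
Proof.
move=> x0; set h := top (x *+ k); have Nh : N h by rewrite /h -topX.
have xk0 : x *+ k != 0 by apply/eqP => /(tfX k_gt0)/eqP; apply/negP.
have DR a : base ((shift (x *+ k) a - a) *+ k) = [~ base (a *+ k), h]%g.
  by rewrite baseR shiftMn mulrnBl.
have fDR a : f (base ((shift (x *+ k) a - a) *+ k)) = [~ f (base (a *+ k)), f h]%g.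
  by rewrite DR (endoR fP) //; apply: domMn.
have [[a0 [Na0 fa0]]|fbase] :=
  pselect (exists a, N (base a) /\ (f (base a)).1 != 0).
  apply: (exponent_of_killed xk0) => a.
  set p := f _; have p1 : p.1 = 0 by rewrite /p fDR wreathR1.
  rewrite (fst0_base p1); congr base; apply: (commute_base_eq0 fa0).
  (* [p] and [f (base a0)] commute, both being images of elements of the abelian
     base group. *)
  rewrite -(fst0_base p1); apply/commgP; rewrite -(endoR fP) //; last exact: domMn.
  by rewrite baseR /= shift0 subrr (endo1 fP).
have {}fbase a : N (base a) -> exists c, f (base a) = base c.
  move=> Na; exists (f (base a)).2; apply: fst0_base.
  by apply: contra_notP fbase => /eqP fa; exists a.
have [y0|y0] := eqVneq (f h).1 0.
  apply: (exponent_of_killed xk0) => a; rewrite fDR (fst0_base y0).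
  have [c ->] := fbase _ (domMn a).
  by rewrite baseR /= shift0 subrr.
apply: exponent_of_invariant => a; have [c cE] := fbase _ (domMn a).
(* Unlike [base a], its commutator with [h] lies in the normal subgroup [N], so
   [f] may be applied before multiplying by [k]. *)
have Ne : N (base (shift (x *+ k) a - a)).
  have -> : base (shift (x *+ k) a - a) = ([~ h, base a]^-1)%g.
    by rewrite invgR baseR.
  by apply: (domV fP); apply: (domR fP).
have [e eE] := fbase _ Ne.
have : base (e *+ k) = [~ base c, f h]%g.
  by rewrite -cE -fDR -!baseX (endoX fP) // eE.
rewrite baseR => /base_inj/esym/(shift_sub_divisible y0)[d dE].
by exists d; rewrite cE dE.
Qed.

End Wreath.

Theorem theorem1 :
  (forall B X : zmodType,
     (exists x : X, x != 0) ->
     torsion_free X ->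
     self_similar (wreath B X) ->
     finite_exponent B) /\
  ~ self_similar (wreath int int).
Proof.
have wreath_exponent (B X : zmodType) : (exists x : X, x != 0) ->
    torsion_free X -> self_similar (wreath B X) -> finite_exponent B.
  move=> [x x0] tfX /self_similar_simple_virtual_endo[k [N [f [k0 Nk fP]]]].
  exact: (simple_virtual_endo_exponent tfX k0 Nk fP x0).
split=> [//|ss].
have tfZ : torsion_free int.
  by move=> x [//|n] _ /eqP; rewrite -mulr_natr mulf_eq0 natz => /orP[/eqP|].
have [|n n0 /(_ 1)] := wreath_exponent int int _ tfZ ss; first by exists 1.
by case: n n0 => // n _; rewrite natz.
Qed.
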